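(* Let $q$ be a power of an odd prime, $R=\mathbf{F}_q[T]$, $k=\mathbf{F}_q(T)$. Let $a\in R\setminus\mathbf{F}_q$ be such that $A=2a+1$ is monic, and let $m$ be any positive integer. Suppose $A=SP$ with $P\in R$ irreducible and $S\in R$, $\deg S\ge 2$. Let $D$ be one of the polynomials $$(A^m+a)^2+A,\qquad (A^m-a)^2+A,\qquad (A^m+a+1)^2-A,\qquad (A^m-a-1)^2-A,$$ and assume that $D$ is square-free and that $K=k(\sqrt{D})$ is a real quadratic function field (i.e. $D$ is monic of even degree). Then the ideal class number $h(D)$ of $K$ satisfies $$h(D)\ge \frac{\deg(SP)}{\deg P}>1.$$
   Context: The ring of integers $\mathcal{O}_K$ of $K$ is the integral closure of $R=\mathbf{F}_q[T]$ in $K$. The ideal class number $h(D)=h(K)$ is the order of the group of fractional ideals of $\mathcal{O}_K$ modulo principal fractional ideals. $K=k(\sqrt{D})$ is called a real quadratic function field when $D$ is monic of even degree and not a square.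
   Formalization: The case D = A+1 is excluded; it arises only for the first polynomial with m = 1 in characteristic 3 (where A+a = 1), and there the bound can fail: q = 3, A = T^4+T, P = T, D = T^4+T+1 has h(D) = 1 < 4. *)

(* Defs.v *)
From HB Require Import structures.
From mathcomp Require Import all_boot all_order all_algebra all_field.
From mathcomp Require Import finmap.
From mathcomp Require Import mathcomp_extra boolp classical_sets cardinality.
From mathcomp Require Import constructive_ereal.

Set Implicit Arguments.
Unset Strict Implicit.
Unset Printing Implicit Defensive.

Import Order.TTheory GRing.Theory Num.Theory.
Local Open Scope classical_set_scope.
Local Open Scope ring_scope.

(* The zero polynomial gets degree 0. *)
Definition deg (F : fieldType) (p : {poly F}) : nat := (size p).-1.

Definition squarefree_poly (F : fieldType) (p : {poly F}) : Prop :=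
  forall u : {poly F}, u ^+ 2 %| p -> size u = 1%N.

Section FunctionField.

Variables (F : fieldType) (K : fieldExtType {fraction {poly F}}).

Definition poly_to_field (p : {poly F}) : K := (FracField.tofrac p)%:A.

(* K = k(sqrt D) with D monic, of even degree, and not a square. *)
Definition real_quadratic (D : {poly F}) : Prop :=
  [/\ D \is monic, ~~ odd (deg D), ~ (exists u : {poly F}, D = u ^+ 2) &
      exists2 s : K, s ^+ 2 = poly_to_field D & <<1%VS; s>>%VS = fullv].

Definition ring_of_integers : set K := [set x | integralOver poly_to_field x].

Record fractional_ideal (I : set K) : Prop := FractionalIdeal {
  fractional_ideal0 : I 0;
  fractional_idealD : forall x y, I x -> I y -> I (x + y);
  fractional_idealM : forall r x, ring_of_integers r -> I x -> I (r * x);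
  fractional_ideal_neq0 : exists2 x, I x & x != 0;
  fractional_ideal_denom :
    exists2 d, ring_of_integers d /\ d != 0 &
      forall x, I x -> ring_of_integers (d * x) }.

Definition principal_ideal (x : K) : set K :=
  [set r * x | r in ring_of_integers].

Definition ideal_mul (I J : set K) : set K :=
  [set z | exists2 s : seq (K * K),
     (forall u, u \in s -> I u.1 /\ J u.2) & z = \sum_(u <- s) u.1 * u.2].

Definition ideal_class (I : set K) : set (set K) :=
  [set ideal_mul I (principal_ideal x) | x in [set x | x != 0]].

(* The quotient group, as the set of cosets of the principal ideals. *)
Definition class_group : set (set (set K)) :=
  [set ideal_class I | I in [set I | fractional_ideal I]].

End FunctionField.

(* The order of a group is a natural number, or +oo if the group is
   infinite. *)
Definition cardinal_order (T : choiceType) (C : set T) : \bar rat :=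
  if `[< finite_set C >] then (#|` fset_set C|%:R)%:E else +oo%E.

Definition class_number (F : fieldType)
    (K : fieldExtType {fraction {poly F}}) : \bar rat :=
  cardinal_order (@class_group F K).

(* Main.v *)
(* Up to signs, all four polynomials have the shape D = B^2 + t A with
   t = +-1 and 2 B + k = 2 A^m + k t A, k = +-1.  Hence alpha = B + sqrt D has
   norm -t A and beta = B + k + sqrt D has norm 2 k A^m.  The quotients
   eta_i = alpha^i beta / A^i (0 <= i <= m) are integral, eta_m is a unit, and
   1, alpha, eta_1, alpha^2, ..., alpha^(m-1), eta_(m-1), eta_m are the
   numerators of the convergents of sqrt D over one period.  Consequently every
   element of R[sqrt D] whose norm has degree < deg A is a polynomial times a
   unit.  On the other hand P splits, and if the i-th and j-th powers (i < j) of
   a prime above P are equivalent, a generator of their quotient has norm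
   dividing P^(j - i) and is divisible by no nonconstant polynomial; this forces
   (j - i) deg P >= deg A. *)

Require Import Defs.
From HB Require Import structures.
From mathcomp Require Import all_boot all_order all_algebra all_field.
From mathcomp Require Import mathcomp_extra boolp classical_sets cardinality.
From mathcomp Require Import constructive_ereal.
From mathcomp Require Import ring zify.

Set Implicit Arguments.
Unset Strict Implicit.
Unset Printing Implicit Defensive.

Import Order.TTheory GRing.Theory Num.Theory.
Local Open Scope ring_scope.

(* The pair (u, v) stands for u + v sqrt D. *)
Definition quad (F : fieldType) (D : {poly F}) : Type :=
  ({poly F} * {poly F})%type.

HB.instance Definition _ (F : fieldType) (D : {poly F}) :=
  GRing.Zmodule.copy (quad D) ({poly F} * {poly F})%type.

(** * The ring R[sqrt D], its conjugation and its norm *)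

Section QuadraticOrder.

Variables (F : fieldType) (D : {poly F}).
Implicit Types (x y z : quad D) (r : {poly F}).

Definition quad_one : quad D := (1, 0).
Definition quad_mul x y : quad D :=
  (x.1 * y.1 + D * (x.2 * y.2), x.1 * y.2 + x.2 * y.1).

Lemma quad_ext x y : x.1 = y.1 -> x.2 = y.2 -> x = y.
Proof. by case: x y => [? ?] [? ?] /= -> ->. Qed.

Lemma quad_mulA : associative quad_mul.
Proof. by move=> x y z; apply: quad_ext => /=; ring. Qed.
Lemma quad_mulC : commutative quad_mul.
Proof. by move=> x y; apply: quad_ext => /=; ring. Qed.
Lemma quad_mul1 : left_id quad_one quad_mul.
Proof. by move=> x; apply: quad_ext => /=; ring. Qed.
Lemma quad_mulDl : left_distributive quad_mul +%R.
Proof. by move=> x y z; apply: quad_ext; rewrite /= ?fst_add ?snd_add; ring. Qed.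
Lemma quad_one_neq0 : quad_one != 0.
Proof. by apply/eqP => -[] /eqP; rewrite oner_eq0. Qed.

HB.instance Definition _ := GRing.Zmodule_isComNzRing.Build (quad D)
  quad_mulA quad_mulC quad_mul1 quad_mulDl quad_one_neq0.

Definition qconj x : quad D := (x.1, - x.2).
Definition qnorm x : {poly F} := x.1 ^+ 2 - D * x.2 ^+ 2.
Definition qscal r : quad D := (r, 0).

Lemma quadM1 x y : (x * y).1 = x.1 * y.1 + D * (x.2 * y.2).
Proof. by []. Qed.
Lemma quadM2 x y : (x * y).2 = x.1 * y.2 + x.2 * y.1.
Proof. by []. Qed.

Lemma qconjM x y : qconj (x * y) = qconj x * qconj y.
Proof. by apply: quad_ext; rewrite /= ?quadM1 ?quadM2 /=; ring. Qed.
Lemma qconjK : involutive qconj.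
Proof. by move=> x; apply: quad_ext; rewrite //= opprK. Qed.
Lemma qnormM x y : qnorm (x * y) = qnorm x * qnorm y.
Proof. by rewrite /qnorm !quadM1 !quadM2; ring. Qed.
Lemma qnorm_conj x : qnorm (qconj x) = qnorm x.
Proof. by rewrite /qnorm /= sqrrN. Qed.
Lemma qnorm_scal r : qnorm (qscal r) = r ^+ 2.
Proof. by rewrite /qnorm /=; ring. Qed.
Lemma qnorm1 : qnorm 1 = 1.
Proof. by rewrite /qnorm /=; ring. Qed.
Lemma qnormX x n : qnorm (x ^+ n) = qnorm x ^+ n.
Proof. by elim: n => [|n IH]; rewrite ?qnorm1 // !exprS qnormM IH. Qed.

Lemma qnormE x : x * qconj x = qscal (qnorm x).
Proof. by apply: quad_ext; rewrite ?quadM1 ?quadM2 /=; rewrite /qnorm; ring. Qed.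

Lemma qscalM r s : qscal (r * s) = qscal r * qscal s.
Proof. by apply: quad_ext; rewrite ?quadM1 ?quadM2 /=; ring. Qed.
Lemma qscalM1 r x : (qscal r * x).1 = r * x.1.
Proof. by rewrite quadM1 /=; ring. Qed.
Lemma qscalM2 r x : (qscal r * x).2 = r * x.2.
Proof. by rewrite quadM2 /=; ring. Qed.

Lemma qscalI r x y : r != 0 -> qscal r * x = qscal r * y -> x = y.
Proof.
move=> r0 E; apply: quad_ext; apply: (mulfI r0).
  by rewrite -!qscalM1 E.
by rewrite -!qscalM2 E.
Qed.

End QuadraticOrder.

(** * Degrees of polynomials, and polynomials whose square is 1 *)

Section Degree.

Variable F : fieldType.
Implicit Types p q : {poly F}.

Lemma deg_size p : p != 0 -> size p = (deg p).+1.
Proof. by move=> p0; rewrite /deg prednK // size_poly_gt0. Qed.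

Lemma degM p q : p != 0 -> q != 0 -> deg (p * q) = (deg p + deg q)%N.
Proof.
by move=> p0 q0; rewrite {1}/deg size_mul // !deg_size // addSn addnS.
Qed.

Lemma degX p n : p != 0 -> deg (p ^+ n) = (n * deg p)%N.
Proof.
move=> p0; elim: n => [|n IH]; first by rewrite expr0 /deg size_poly1.
by rewrite exprS degM ?expf_neq0 // IH mulSn.
Qed.

Lemma deg_sqr1 p : p ^+ 2 = 1 -> deg p = 0%N.
Proof.
move=> h; have p0 : p != 0 by apply: contra_eq_neq h => ->; rewrite expr0n eq_sym oner_neq0.
by have := degX 2 p0; rewrite h {1}/deg size_poly1 => /esym/eqP; rewrite muln_eq0 => /eqP.
Qed.

Lemma coprimep_sqr1 p q : p ^+ 2 = 1 -> coprimep q p.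
Proof. by move=> h; apply/Bezout_eq1_coprimepP; exists (0, p); rewrite /= -h; ring. Qed.

End Degree.

(** * Sizes at the two infinite places of K *)

Section Dominance.

Variables (F : fieldType) (D B E : {poly F}).
Hypothesis two_neq0 : (2 : {poly F}) != 0.
Hypothesis D_eq : D = B ^+ 2 + E.
Hypothesis E_neq0 : E != 0.
Hypothesis B_gt0 : (0 < deg B)%N.
Hypothesis E_le_B : (deg E <= deg B)%N.
Implicit Types x y z : quad D.

(* Approximates z at the infinite place where sqrt D is close to B; [dominant z]
   says that z is at least as large there as at the conjugate place. *)
Definition lead_approx z : {poly F} := z.1 + z.2 * B.

Definition dominant z :=
  (lead_approx z != 0) && (size (lead_approx (qconj z)) <= size (lead_approx z))%N.

Local Notation dg z := (deg (lead_approx z)).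

Lemma B_neq0 : B != 0.
Proof. by apply: contraTneq B_gt0 => ->; rewrite /deg size_poly0. Qed.

Lemma lead_approxM x y :
  lead_approx (x * y) = lead_approx x * lead_approx y + x.2 * y.2 * E.
Proof. by rewrite /lead_approx quadM1 quadM2 D_eq; ring. Qed.

Lemma lead_approx_sub z :
  lead_approx z - lead_approx (qconj z) = 2 * (z.2 * B).
Proof. by rewrite /lead_approx /=; ring. Qed.

(** The difference of the approximations of [z] and its conjugate is [2 * (z.2 * B)]; by dominance
    it is no larger than [lead_approx z]. *)
Lemma snd_deg z : dominant z -> z.2 != 0 -> (deg z.2 + deg B <= dg z)%N.
Proof.
move=> /andP[z0 zd] z2.
have : (size (2 * (z.2 * B) : {poly F})%R <= size (lead_approx z))%N.
  rewrite -lead_approx_sub; apply: leq_trans (size_polyD _ _) _.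
  by rewrite size_polyN geq_max leqnn.
have B0 := B_neq0.
rewrite !deg_size ?mulf_neq0 // ltnS !degM ?mulf_neq0 //.
by apply: leq_trans; rewrite leq_addl.
Qed.

(** This bounds the error term of [lead_approxM]: by [snd_deg] the two second coordinates save
    [deg B] twice, while [E] costs at most [deg B] once. *)
Lemma size_cross x y : dominant x -> dominant y ->
  (size (x.2 * y.2 * E)%R < size (lead_approx x * lead_approx y)%R)%N.
Proof.
move=> dx dy; have [x0 _] := andP dx; have [y0 _] := andP dy.
rewrite (deg_size (mulf_neq0 x0 y0)).
have [->|xy] := eqVneq (x.2 * y.2) 0; first by rewrite mul0r size_poly0.
rewrite (deg_size (mulf_neq0 xy E_neq0)) ltnS.
move: xy; rewrite mulf_eq0 negb_or => /andP[x2 y2].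
have := snd_deg dx x2; have := snd_deg dy y2.
rewrite !degM ?mulf_neq0 //; move: B_gt0 E_le_B; lia.
Qed.

Lemma dominantM x y : dominant x -> dominant y ->
  dominant (x * y) /\ dg (x * y)%R = (dg x + dg y)%N.
Proof.
move=> dx dy; have sz := size_cross dx dy.
have [x0 xd] := andP dx; have [y0 yd] := andP dy.
have xy0 := mulf_neq0 x0 y0.
have szM : size (lead_approx (x * y)) = size (lead_approx x * lead_approx y).
  by rewrite lead_approxM size_polyDl.
split; last by rewrite -degM // /deg szM.
rewrite /dominant -size_poly_gt0 szM size_poly_gt0 xy0 /=.
(* The two sign changes cancel, so the error term is the same for the conjugates. *)
rewrite qconjM lead_approxM /= mulrNN.
apply: leq_trans (size_polyD _ _) _; rewrite geq_max (ltnW sz) andbT.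
have [->|x'0] := eqVneq (lead_approx (qconj x)) 0; first by rewrite mul0r size_poly0.
have [->|y'0] := eqVneq (lead_approx (qconj y)) 0; first by rewrite mulr0 size_poly0.
move: xd yd; rewrite !deg_size ?mulf_neq0 // !ltnS !degM //; lia.
Qed.

Lemma dominant_qscal r : r != 0 -> dominant (qscal D r) /\ dg (qscal D r) = deg r.
Proof.
by move=> r0; rewrite /dominant /lead_approx /= oppr0 !mul0r !addr0 r0 leqnn.
Qed.

Lemma dominantX x n : dominant x ->
  dominant (x ^+ n) /\ dg (x ^+ n) = (n * dg x)%N.
Proof.
move=> dx; elim: n => [|n [dn IH]].
  by have [? ->] := @dominant_qscal 1 (oner_neq0 _); rewrite /deg size_poly1.
by rewrite exprS; have [? ->] := dominantM dx dn; rewrite IH mulSn.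
Qed.

Lemma lead_approx_qscal r z : lead_approx (qscal D r * z) = r * lead_approx z.
Proof. by rewrite /lead_approx qscalM1 qscalM2; ring. Qed.

Lemma dominant_qscall r z : r != 0 -> dominant (qscal D r * z) = dominant z.
Proof.
move=> r0; rewrite /dominant.
have -> : qconj (qscal D r * z) = qscal D r * qconj z.
  by rewrite qconjM; congr (_ * _); apply: quad_ext; rewrite //= oppr0.
rewrite !lead_approx_qscal mulf_eq0 (negPf r0) /=.
have [->|z0] /= := eqVneq (lead_approx z) 0; first by [].
have [->|z'0] := eqVneq (lead_approx (qconj z)) 0; first by rewrite mulr0 size_poly0.
by rewrite !deg_size ?mulf_neq0 // !degM // !ltnS leq_add2l.
Qed.

(** Sizes are totally ordered, so only the vanishing of both approximations could interfere; their
    sum [2 * z.1] and difference [2 * (z.2 * B)] would then force [z = 0]. *)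
Lemma dominant_or_conj z : z != 0 -> dominant z \/ dominant (qconj z).
Proof.
move=> z0; rewrite /dominant qconjK.
have sum : lead_approx z + lead_approx (qconj z) = 2 * z.1.
  by rewrite /lead_approx /=; ring.
have [a0|a0] := eqVneq (lead_approx z) 0.
  have [b0|b0] := eqVneq (lead_approx (qconj z)) 0.
    case/eqP: z0; apply: quad_ext => /=.
      by apply: (mulfI two_neq0); rewrite -sum a0 b0 addr0 mulr0.
    apply: (mulIf B_neq0); apply: (mulfI two_neq0).
    by rewrite -lead_approx_sub a0 b0 subr0 mul0r mulr0.
  by right; rewrite a0 size_poly0.
have [b0|b0] := eqVneq (lead_approx (qconj z)) 0.
  by left; rewrite b0 size_poly0.
by case/orP: (leq_total (size (lead_approx (qconj z))) (size (lead_approx z))) => ->; [left|right].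
Qed.

Lemma snd_eq0 z : dominant z -> (dg z < deg B)%N -> z.2 = 0.
Proof.
move=> dz; rewrite ltnNge; apply: contraNeq => /(snd_deg dz).
by apply: leq_trans; rewrite leq_addl.
Qed.

(* The two infinite valuations of [z * qconj y] are [v1 z + v2 y] and
   [v2 z + v1 y]; whichever is larger is the [dg] of the dominant one among
   the product and its conjugate. *)
Lemma dominant_mul_conj z y : dominant z -> dominant y ->
    qnorm z != 0 -> qnorm y != 0 ->
  (dominant (z * qconj y) /\ (dg (z * qconj y)%R + dg y = dg z + deg (qnorm y))%N) \/
  (dominant (qconj z * y) /\ (dg (qconj z * y)%R + dg z = dg y + deg (qnorm z))%N).
Proof.
move=> dz dy nz ny.
(* Multiplying by [w] turns [x * qconj w] into [qnorm w] times [x], and [dg] is additive on dominant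
   factors. *)
have key x w : dominant x -> dominant w -> qnorm w != 0 -> dominant (x * qconj w) ->
    (dg (x * qconj w)%R + dg w = dg x + deg (qnorm w))%N.
  move=> dx dw nw d.
  have [_ <-] := dominantM d dw.
  have -> : x * qconj w * w = qscal D (qnorm w) * x by rewrite -qnormE; ring.
  by rewrite lead_approx_qscal degM // 1?addnC //; case/andP: dx.
have n0 : z * qconj y != 0.
  have : qnorm (z * qconj y) != 0 by rewrite qnormM qnorm_conj mulf_neq0.
  by apply: contraNneq => ->; rewrite /qnorm /=; apply/eqP; ring.
case: (dominant_or_conj n0) => d; first by left; split => //; exact: key.
right; rewrite qconjM qconjK in d; split => //.
by rewrite mulrC; apply: key => //; rewrite mulrC.
Qed.

(** Here [x] and [y] act as consecutive convergents: their determinant [(x * qconj y).2] is a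
    nonzero constant, so they form a basis of R[sqrt D]. An element of small norm whose size lies
    between theirs has no [y]-component. *)
Lemma multiple_of_minimum z x y :
    dominant z -> dominant x -> dominant y ->
    qnorm z != 0 -> qnorm x != 0 -> deg (x * qconj y).2 = 0%N -> (x * qconj y).2 != 0 ->
    (dg y + deg (qnorm x) = deg B + dg x)%N ->
    (dg x <= dg z < dg y)%N -> (deg (qnorm z) < deg B)%N ->
  exists r, z = qscal D r * x.
Proof.
move=> dz dx dy nz nx c1 c0 gap /andP[lxz lzy] nzB.
(* Whichever of [z * qconj x] and its conjugate is dominant has size below [deg B]: in one case by
   [gap] and [dg z < dg y], in the other by the small norm of [z] and [dg x <= dg z]. *)
have v0 : (z * qconj x).2 = 0.
  have [[d e]|[d e]] := dominant_mul_conj dz dx nz nx.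
    by apply: snd_eq0 => //; lia.
  have : (qconj z * x).2 = 0 by apply: snd_eq0 => //; lia.
  by rewrite !quadM2 /= => h; rewrite -[RHS]oppr0 -[in RHS]h; ring.
have /size_poly1P[c cn0 cE] : size (x * qconj y).2 == 1%N by rewrite deg_size // c1.
exists (c^-1%:P * (z * qconj y).2).
(* Cramer's rule for three vectors in a module of rank 2. *)
have plucker : qscal D (x * qconj y).2 * z
    = qscal D (z * qconj y).2 * x - qscal D (z * qconj x).2 * y.
  by apply: quad_ext => /=; ring.
apply: (@qscalI _ _ (x * qconj y).2) => //.
rewrite plucker v0 cE mulrA -qscalM mulrA -polyCM mulfV // mul1r.
by apply: quad_ext => /=; ring.
Qed.

End Dominance.

(** * Elements of small norm are polynomials times units *)

Section Kreeper.

Variables (F : fieldType) (D A B k t : {poly F}) (m : nat).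
Hypothesis two_neq0 : (2 : {poly F}) != 0.
Hypothesis k2 : k ^+ 2 = 1.
Hypothesis t2 : t ^+ 2 = 1.
Hypothesis D_eq : D = B ^+ 2 + t * A.
Hypothesis B_eq : 2 * B + k = 2 * A ^+ m + k * t * A.
Hypothesis A_gt0 : (0 < deg A)%N.
Hypothesis m_gt0 : (0 < m)%N.
Hypothesis degB : deg B = (m * deg A)%N.
Implicit Types x y z : quad D.

Local Notation dg z := (deg (lead_approx B z)).
Local Notation dom := (dominant B).

Definition alpha : quad D := (B, 1).
Definition beta : quad D := (B + k, 1).

Let A_neq0 : A != 0.
Proof. by apply: contraTneq A_gt0 => ->; rewrite /deg size_poly0. Qed.

Let sqr1_neq0 (p : {poly F}) : p ^+ 2 = 1 -> p != 0.
Proof. by move=> h; apply: contra_eq_neq h => ->; rewrite expr0n eq_sym oner_neq0. Qed.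

Let t_neq0 := sqr1_neq0 t2.
Let k_neq0 := sqr1_neq0 k2.

Let E_neq0 : t * A != 0. Proof. exact: mulf_neq0. Qed.

Let B_gt0 : (0 < deg B)%N. Proof. by rewrite degB muln_gt0 m_gt0. Qed.

Let E_le_B : (deg (t * A)%R <= deg B)%N.
Proof. by rewrite degM // deg_sqr1 // add0n degB leq_pmull. Qed.

Let deg2 : deg (2 : {poly F}) = 0%N.
Proof.
have -> : (2 : {poly F}) = (2 : F)%:P by rewrite rmorphMn rmorph1.
by rewrite /deg size_polyC; case: (_ != 0).
Qed.

Let degN (p : {poly F}) : deg (- p) = deg p. Proof. by rewrite /deg size_polyN. Qed.

Lemma qnorm_alpha : qnorm alpha = - (t * A).
Proof. by rewrite /qnorm /= D_eq; ring. Qed.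

Lemma qnorm_beta : qnorm beta = 2 * k * A ^+ m.
Proof.
have -> : qnorm beta = k * (2 * B + k) - t * A by rewrite /qnorm /= D_eq; ring.
by rewrite B_eq; ring: k2.
Qed.

Lemma dominant_of_approx z :
  (deg (lead_approx B (qconj z)) < dg z)%N -> dom z.
Proof.
move=> lt; have z0 : lead_approx B z != 0.
  by apply: contraTneq lt => ->; rewrite /deg size_poly0.
rewrite /dominant z0 /=.
have [->|c0] := eqVneq (lead_approx B (qconj z)) 0; first by rewrite size_poly0.
by rewrite !deg_size // ltnS ltnW.
Qed.

Lemma dominant_alpha : dom alpha /\ dg alpha = deg B.
Proof.
have e : lead_approx B alpha = 2 * B by rewrite /lead_approx /=; ring.
have d : dg alpha = deg B by rewrite e degM // ?B_neq0 // deg2.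
split=> //; apply: dominant_of_approx.
have -> : lead_approx B (qconj alpha) = 0 by rewrite /lead_approx /=; ring.
by rewrite d /deg size_poly0.
Qed.

Lemma dominant_beta : dom beta /\ dg beta = deg B.
Proof.
have e : lead_approx B beta = 2 * B + k by rewrite /lead_approx /=; ring.
have B0 : B != 0 by rewrite B_neq0.
have d : dg beta = deg B.
  rewrite /deg e size_polyDl.
    by rewrite -/(deg _) degM // deg2.
  by rewrite !deg_size ?mulf_neq0 // ltnS deg_sqr1 // degM // deg2.
split=> //; apply: dominant_of_approx.
have -> : lead_approx B (qconj beta) = k by rewrite /lead_approx /=; ring.
by rewrite d deg_sqr1.
Qed.

(** The witness is eta_i, built by dividing [alpha * z] by [A] at each step. For [i < m] the norm of
    [z] is divisible by [A], and modulo [A] it is [(z.1 + z.2 * B) * (z.1 - z.2 * B)]; the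
    coprimality invariant puts [A] into the first factor. *)
Lemma eta_exists i : (i <= m)%N -> exists z : quad D,
  [/\ alpha ^+ i * beta = qscal D (A ^+ i) * z,
      coprimep A (z.1 - z.2 * B) &
      qnorm z = (- t) ^+ i * (2 * k) * A ^+ (m - i)].
Proof.
elim: i => [|i IH] im.
  exists beta; split; last by rewrite qnorm_beta subn0 expr0 mul1r.
    by rewrite !expr0; apply: quad_ext => /=; ring.
  have -> : (beta.1 - beta.2 * B) = k by rewrite /=; ring.
  by rewrite coprimep_sqr1.
have [z [ez cz nz]] := IH (ltnW im).
have dv : A %| (z.1 + z.2 * B).
  rewrite -(Gauss_dvdpl _ cz).
  have -> : (z.1 + z.2 * B) * (z.1 - z.2 * B) = qnorm z + t * A * z.2 ^+ 2.
    by rewrite /qnorm D_eq; ring.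
  rewrite dvdp_add //; last by rewrite mulrAC dvdp_mull.
  have [n en] : exists n, (m - i = n.+1)%N by exists (m - i.+1)%N; lia.
  by rewrite nz en exprS mulrCA dvdp_mulr.
have [q eq] := dvdpP _ _ dv.
(* This is [alpha * z] divided by [A]: its coordinates are [B * (z.1 + z.2 * B) + t * A * z.2] and
   [z.1 + z.2 * B = q * A]. *)
exists (B * q + t * z.2, q).
have z1 : z.1 = q * A - z.2 * B by rewrite -eq addrK.
have ez' : alpha * z = qscal D A * (B * q + t * z.2, q).
  by apply: quad_ext; rewrite ?quadM1 ?quadM2 /= z1 ?D_eq; ring.
split.
- by rewrite exprS -mulrA ez mulrCA ez' exprSr qscalM mulrA.
- have -> : B * q + t * z.2 - q * B = t * z.2 by ring.
  (* Modulo [A] the old invariant concerns [- (2 * B) * z.2], so [A] is coprime to [z.2]. *)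
  move: cz; rewrite z1.
  have -> : q * A - z.2 * B - z.2 * B = q * A + - (2 * B) * z.2 by ring.
  rewrite coprimep_addl_mul !coprimepMr => /andP[_ ->]; rewrite andbT.
  by rewrite coprimep_sqr1.
have : A ^+ 2 != 0 by rewrite expf_neq0.
move/mulfI; apply.
have := congr1 (@qnorm _ _) ez'; rewrite !qnormM qnorm_scal => <-.
rewrite qnorm_alpha nz.
have -> : (m - i = (m - i.+1).+1)%N by lia.
by rewrite !exprS; ring.
Qed.

Lemma eta_dominant i z : alpha ^+ i * beta = qscal D (A ^+ i) * z ->
  dom z /\ (dg z + i * deg A = i.+1 * deg B)%N.
Proof.
move=> ez; have Ai : A ^+ i != 0 by rewrite expf_neq0.
have [da ga] := dominant_alpha; have [db gb] := dominant_beta.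
have [dai gai] := dominantX two_neq0 D_eq E_neq0 B_gt0 E_le_B i da.
have [d g] := dominantM two_neq0 D_eq E_neq0 B_gt0 E_le_B dai db.
move: d g; rewrite ez dominant_qscall // lead_approx_qscal => dz.
by rewrite degM ?degX //; [lia | case/andP: dz].
Qed.

Lemma deg_qnorm_alphaX i : qnorm (alpha ^+ i) != 0 /\ deg (qnorm (alpha ^+ i)) = (i * deg A)%N.
Proof.
rewrite qnormX qnorm_alpha degX ?oppr_eq0 // degN degM // deg_sqr1 //.
by rewrite expf_neq0 // oppr_eq0.
Qed.

Lemma deg_eta_norm i n : let c := (- t) ^+ i * (2 * k) * A ^+ n in
  c != 0 /\ deg c = (n * deg A)%N.
Proof.
have c0 : (- t) ^+ i * (2 * k) != 0 by rewrite !mulf_neq0 // expf_neq0 // oppr_eq0.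
split=> /=; first by rewrite mulf_neq0 // expf_neq0.
rewrite degM ?expf_neq0 // !degM ?expf_neq0 ?mulf_neq0 ?oppr_eq0 // !degX ?oppr_eq0 //.
by rewrite degN (deg_sqr1 t2) (deg_sqr1 k2) deg2 muln0.
Qed.

(** Up to the factor [A ^+ i] the product is [qnorm alpha ^+ i] times the conjugate of [beta]. This
    and the next determinant supply the constants that [multiple_of_minimum] requires. *)
Lemma alphaX_eta_cross i z : alpha ^+ i * beta = qscal D (A ^+ i) * z ->
  (alpha ^+ i * qconj z).2 = - (- t) ^+ i.
Proof.
move=> ez; apply: (mulfI (expf_neq0 i A_neq0)).
have cz : qscal D (A ^+ i) * qconj z = qconj (alpha ^+ i * beta).
  by rewrite ez qconjM; congr (_ * _); apply: quad_ext; rewrite //= oppr0.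
rewrite -qscalM2 mulrCA cz qconjM mulrA qnormE qnormX qnorm_alpha qscalM2 /=.
by rewrite -mulNr exprMn; ring.
Qed.

Lemma eta_alphaX_cross i z : alpha ^+ i * beta = qscal D (A ^+ i) * z ->
  (z * qconj (alpha ^+ i.+1)).2 = - ((- t) ^+ i * k).
Proof.
move=> ez; apply: (mulfI (expf_neq0 i A_neq0)).
rewrite -qscalM2 mulrA -ez exprSr qconjM mulrACA.
rewrite qnormE qnormX qnorm_alpha qscalM2 /=.
by rewrite -mulNr exprMn; ring.
Qed.

Lemma deg_unitX (p q : {poly F}) i : p ^+ 2 = 1 -> q ^+ 2 = 1 ->
  deg (- ((- p) ^+ i * q)) = 0%N /\ - ((- p) ^+ i * q) != 0.
Proof.
move=> hp hq; have p0 := sqr1_neq0 hp; have q0 := sqr1_neq0 hq.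
rewrite degN degM ?degX ?expf_neq0 ?oppr_eq0 // degN !deg_sqr1 // muln0.
by rewrite mulf_neq0 // expf_neq0 // oppr_eq0.
Qed.

(** The element eta_i cuts the window between the sizes of [alpha ^+ i] and [alpha ^+ i.+1] in two.
    On the lower part [z] is a multiple of [alpha ^+ i], whose norm has degree [i * deg A], so
    [i = 0]. On the upper part it would be a multiple of eta_i, whose norm has degree at least
    [deg A]. *)
Lemma small_norm_bounded i z : dom z -> qnorm z != 0 ->
    (deg (qnorm z) < deg A)%N -> (i < m)%N ->
    (i * deg B <= dg z < i.+1 * deg B)%N ->
  exists r u, [/\ z = qscal D r * u, qnorm u != 0 & deg (qnorm u) = 0%N].
Proof.
move=> dz nz nzA im /andP[lo hi].
have [w [ew _ nw]] := eta_exists (ltnW im).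
have [dw gw] := eta_dominant ew.
have [da ga] := dominant_alpha.
have X j := dominantX two_neq0 D_eq E_neq0 B_gt0 E_le_B j da.
have [dai gai] := X i; have [dai1 gai1] := X i.+1.
have [na dna] := deg_qnorm_alphaX i.
have [nw0 dnw] := deg_eta_norm i (m - i); rewrite -nw in nw0 dnw.
have nzB : (deg (qnorm z) < deg B)%N by apply: leq_trans nzA _; rewrite degB leq_pmull.
have degz r x : qnorm x != 0 -> z = qscal D r * x -> (deg (qnorm x) <= deg (qnorm z))%N.
  move=> nx ez; move: nz; rewrite ez qnormM mulf_eq0 => /norP[nr _].
  by rewrite degM // leq_addl.
have min := multiple_of_minimum two_neq0 D_eq E_neq0 B_gt0 E_le_B dz.
have [lt|ge] := ltnP (dg z) (dg w).
  have [c1 c0] := deg_unitX i t2 (expr1n _ 2).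
  rewrite mulr1 -(alphaX_eta_cross ew) in c1 c0.
  have [||r ez] := min _ _ dai dw nz na c1 c0 _ _ nzB.
  - by rewrite dna gai ga gw mulSn.
  - by rewrite gai ga lo.
  exists r, (alpha ^+ i); split=> //; have := degz _ _ na ez.
  by rewrite dna; case: (i) => // j /(leq_trans (leq_pmull _ _)) => /(_ isT); rewrite leqNgt nzA.
have [c1 c0] := deg_unitX i t2 k2; rewrite -(eta_alphaX_cross ew) in c1 c0.
have [||r ez] := min _ _ dw dai1 nz nw0 c1 c0 _ _ nzB.
- rewrite dnw gai1 ga -gw -addnA -mulnDl subnKC 1?ltnW // -degB.
  by rewrite addnC.
- by rewrite ge gai1 ga hi.
have := degz _ _ nw0 ez; rewrite dnw => /(leq_trans (leq_pmull _ _)).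
by rewrite subn_gt0 im leqNgt nzA => /(_ isT).
Qed.

(** Here [w] is eta_m, of constant norm and size [m * deg B]. Multiplying by its conjugate lowers
    the size, passing to conjugates when needed, until one of the windows [i < m] is reached. *)
Lemma small_norm z : qnorm z != 0 -> (deg (qnorm z) < deg A)%N ->
  exists r u, [/\ z = qscal D r * u, qnorm u != 0 & deg (qnorm u) = 0%N].
Proof.
have conj_scal r : qconj (qscal D r) = qscal D r by apply: quad_ext; rewrite //= oppr0.
have conj_case x : (exists r u, [/\ qconj x = qscal D r * u, qnorm u != 0 & deg (qnorm u) = 0%N]) ->
  exists r u, [/\ x = qscal D r * u, qnorm u != 0 & deg (qnorm u) = 0%N].
  move=> [r [u [e n d]]]; exists r, (qconj u); rewrite qnorm_conj; split=> //.
  by rewrite -[x]qconjK e qconjM conj_scal.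
have [w [ew _]] := eta_exists (leqnn m).
rewrite subnn expr0 mulr1 => nw.
have [nw0 dnw] := deg_eta_norm m 0; rewrite expr0 mulr1 -nw mul0n in nw0 dnw.
have [dw gw] := eta_dominant ew.
have {}gw : dg w = (m * deg B)%N by move: gw; rewrite -degB mulSn; lia.
have D0 x : qnorm x != 0 -> dom x \/ dom (qconj x).
  move=> nx; apply: dominant_or_conj => //.
  by apply: contraNneq nx => ->; rewrite /qnorm /=; apply/eqP; ring.
suff main n x : (dg x < n)%N -> dom x -> qnorm x != 0 -> (deg (qnorm x) < deg A)%N ->
    exists r u, [/\ x = qscal D r * u, qnorm u != 0 & deg (qnorm u) = 0%N].
  move=> nz dz; have [d|d] := D0 _ nz; first exact: main (leqnn _) d nz dz.
  by apply: conj_case; apply: main (leqnn _) d _ _; rewrite qnorm_conj.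
elim: n x => // n IH x xn dx nx nxA.
have [lt|ge] := ltnP (dg x) (m * deg B).
  apply: (@small_norm_bounded (dg x %/ deg B)) => //; first by rewrite ltn_divLR.
  by rewrite leq_trunc_div ltn_ceil.
have nc : qnorm (x * qconj w) = qnorm x * qnorm w by rewrite qnormM qnorm_conj.
have nc0 : qnorm (x * qconj w) != 0 by rewrite nc mulf_neq0.
have dnc : deg (qnorm (x * qconj w)) = deg (qnorm x) by rewrite nc degM // dnw addn0.
have AB : (deg A <= m * deg B)%N.
  by rewrite degB; apply: leq_trans (leq_pmull _ m_gt0) (leq_pmull _ m_gt0).
have B0 := B_gt0.
have mB : (0 < m * deg B)%N by rewrite muln_gt0 m_gt0.
(* A factorization of [x * qconj w] is carried back to [x] by multiplying with [w] and dividing by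
   the constant [c = qnorm w]. *)
have back : (exists r u, [/\ x * qconj w = qscal D r * u, qnorm u != 0 & deg (qnorm u) = 0%N]) ->
  exists r u, [/\ x = qscal D r * u, qnorm u != 0 & deg (qnorm u) = 0%N].
  move=> [r [u [e n0 d0]]].
  have /size_poly1P[c c0 cE] : size (qnorm w) == 1%N by rewrite deg_size // dnw.
  exists (c^-1%:P * r), (u * w); rewrite qnormM mulf_neq0 // degM // d0 dnw; split => //.
  apply: (@qscalI _ _ (qnorm w)) => //.
  rewrite -[in LHS]qnormE mulrAC -mulrA e [RHS]mulrA -qscalM.
  have -> : qnorm w * (c^-1%:P * r) = r by rewrite cE mulrA -polyCM mulfV // mul1r.
  by ring.
apply: back.
(* In the first case the size drops by [m * deg B]; in the second the new size is at most
   [deg (qnorm x)], which is below [deg A] and hence below [dg x]. *)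
have [[d e]|[d e]] := dominant_mul_conj two_neq0 D_eq E_neq0 B_gt0 E_le_B dx dw nx nw0.
  by apply: IH => //; [lia | rewrite dnc].
apply: conj_case; apply: IH; rewrite ?qnorm_conj ?dnc //.
  by rewrite qconjM qconjK; lia.
by rewrite qconjM qconjK.
Qed.

End Kreeper.

(** * The polynomial ring is integrally closed *)

Section IntegralClosure.

Variable F : fieldType.
Local Notation tofrac := (@FracField.tofrac {poly F}).

Lemma fractionP (x : {fraction {poly F}}) :
  exists n d : {poly F}, [/\ d != 0, coprimep n d & x * tofrac d = tofrac n].
Proof.
have [n [d [d0 e]]] : exists n d, d != 0 /\ x * tofrac d = tofrac n.
  rewrite -[x]reprK; move: (repr x) => r; exists r.1, r.2; split; first exact: denom_ratioP.
  unlock FracField.tofrac; rewrite -[LHS]FracField.pi_mul; apply/eqmodP => /=.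
  have r0 := denom_ratioP r.
  by rewrite FracField.equivfE /FracField.mulf !numden_Ratio ?mulr1 ?oner_neq0 // mulrC.
have g0 : gcdp n d != 0 by rewrite gcdp_eq0 negb_and d0 orbT.
exists (n %/ gcdp n d), (d %/ gcdp n d); split.
- by rewrite dvdp_div_eq0 ?dvdp_gcdr.
- by rewrite coprimep_div_gcd // d0 orbT.
have tg : tofrac (gcdp n d) != 0 by rewrite tofrac_eq0.
apply: (mulIf tg); rewrite -mulrA -!tofracM !divpK ?dvdp_gcdl ?dvdp_gcdr //.
Qed.

Lemma tofrac_inj : injective tofrac.
Proof. by move=> p q /eqP; rewrite tofrac_eq => /eqP. Qed.

Lemma integral_fraction (x : {fraction {poly F}}) :
  integralOver tofrac x -> exists p, x = tofrac p.
Proof.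
case=> p mp; rewrite /root horner_coef (size_map_inj_poly tofrac_inj (tofrac0 _)) => /eqP px.
have [n [d [d0 cnd xd]]] := fractionP x.
have sp : size p = (size p).-1.+1 by rewrite prednK // size_poly_gt0 monic_neq0.
set N := (size p).-1 in sp.
suff d1 : size d == 1%N.
  have [c c0 dE] := size_poly1P _ d1.
  exists (c^-1%:P * n); rewrite tofracM -xd dE mulrCA -tofracM -polyCM mulVf // polyC1.
  by rewrite tofrac1 mulr1.
suff dn : d %| n ^+ N.
  have : d %| 1 by rewrite -(@Gauss_dvdpl _ 1 (n ^+ N)) ?mul1r // coprimep_expr // coprimep_sym.
  by rewrite dvdp1.
(* Rational root argument: the equation [p(n / d) = 0] times [d ^+ N], with the monic top term split
   off. The truncated subtraction is exact because [i < N]. *)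
have id_ : n ^+ N + d * \sum_(i < N) p`_i * n ^+ i * d ^+ (N.-1 - i) = 0.
  apply/eqP; rewrite -tofrac_eq0; apply/eqP.
  rewrite -(mul0r (tofrac d ^+ N)) -px sp big_ord_recr /= mulrDl addrC.
  rewrite tofracD tofracM rmorph_sum mulr_sumr mulr_suml /=; congr (_ + _).
    apply: eq_bigr => i _; rewrite coef_map /= !tofracM !tofracXn -xd exprMn.
    have -> : tofrac d ^+ N = tofrac d ^+ i * (tofrac d * tofrac d ^+ (N.-1 - i)).
      by rewrite -exprS -exprD; congr (_ ^+ _); have := ltn_ord i; lia.
    by ring.
  rewrite coef_map /= -[p`_N]/(lead_coef p) (monicP mp) tofrac1 mul1r.
  by rewrite tofracXn -xd exprMn.
move/eqP: id_; rewrite addr_eq0 => /eqP ->.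
by rewrite dvdpNr dvdp_mulr.
Qed.

End IntegralClosure.

(** * The quadratic field K and its ring of integers *)

HB.instance Definition _ (F : fieldType) (K : fieldExtType {fraction {poly F}}) :=
  GRing.RMorphism.copy (@poly_to_field F K)
    (in_alg K \o @FracField.tofrac {poly F}).

Section QuadraticField.

Variables (F : fieldType) (D : {poly F}).
Variables (K : fieldExtType {fraction {poly F}}) (s : K).
Hypothesis two_neq0 : (2 : {poly F}) != 0.
Hypothesis s2 : s ^+ 2 = poly_to_field K D.
Hypothesis s_gen : <<1%VS; s>>%VS = fullv.
Hypothesis D_nonsquare : ~ exists u : {poly F}, D = u ^+ 2.
Hypothesis D_sqf : squarefree_poly D.

Local Notation tofrac := (@FracField.tofrac {poly F}).
Local Notation iota := (@poly_to_field F K).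
Implicit Types a b : {fraction {poly F}}.

Lemma integral_scalar a : integralOver iota a%:A -> exists p, a = tofrac p.
Proof.
case=> p mp rp; apply: integral_fraction; exists p => //.
move: rp; have -> : map_poly iota p = map_poly (in_alg K) (map_poly tofrac p).
  by rewrite -map_poly_comp.
by rewrite -[a%:A]/(in_alg K a) fmorph_root.
Qed.

Lemma integral_sqrt : integralOver iota s.
Proof.
exists ('X^2 - D%:P); first by rewrite monicXnsubC.
by rewrite rmorphB /= map_polyXn map_polyC /= /root !hornerE s2 subrr.
Qed.

Lemma sqrt_not_scalar a : s <> a%:A.
Proof.
move=> sa; have [p ap] : exists p, a = tofrac p.
  by apply: integral_scalar; rewrite -sa; exact: integral_sqrt.
apply: D_nonsquare; exists p; apply: tofrac_inj; apply: (fmorph_inj (in_alg K)).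
by rewrite tofracXn -ap rmorphXn /= -sa s2.
Qed.

Lemma quad_coord_eq0 a b : a%:A + b%:A * s = 0 -> a = 0 /\ b = 0.
Proof.
move=> e; have [b0|b0] := eqVneq b 0.
  split=> //; move: e; rewrite b0 scale0r mul0r addr0.
  by move/eqP; rewrite scaler_eq0 oner_eq0 orbF => /eqP.
have b'0 : b%:A != 0 :> K by rewrite scaler_eq0 oner_eq0 orbF.
case: (@sqrt_not_scalar (- (b^-1 * a))).
apply: (mulfI b'0); apply: (@addrI _ a%:A).
rewrite e -[in RHS](rmorphM (in_alg K)) -[in RHS](rmorphD (in_alg K)).
by rewrite mulrN mulVKf // subrr rmorph0.
Qed.

(** This replaces the Galois conjugation of K: conjugate arguments give conjugate values, so the
    conjugate of a root is a root. *)
Lemma horner_quad_coord (p : {poly {poly F}}) a b : exists c d,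
  (map_poly iota p).[a%:A + b%:A * s] = c%:A + d%:A * s /\
  (map_poly iota p).[a%:A - b%:A * s] = c%:A - d%:A * s.
Proof.
elim/poly_ind: p => [|p r [c [d [e1 e2]]]].
  by exists 0, 0; rewrite rmorph0 !horner0 scale0r mul0r subr0 addr0.
exists (c * a + d * b * tofrac D + tofrac r), (c * b + d * a).
rewrite !rmorphD !rmorphM /= map_polyX map_polyC !hornerE e1 e2.
have M (x y : {fraction {poly F}}) : (x * y)%:A = x%:A * y%:A :> K by exact: (rmorphM (in_alg K)).
have A (x y : {fraction {poly F}}) : (x + y)%:A = x%:A + y%:A :> K by exact: (rmorphD (in_alg K)).
rewrite !A !M -[_ r]/((tofrac r)%:A) -[(tofrac D)%:A]s2.
by split; ring.
Qed.

Lemma field_coord (x : K) : exists a b, x = a%:A + b%:A * s.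
Proof.
have : x \in <<1; s>>%VS by rewrite s_gen memvf.
case/Fadjoin1_polyP => p ->.
have M (y z : {fraction {poly F}}) : (y * z)%:A = y%:A * z%:A :> K by exact: (rmorphM (in_alg K)).
have A (y z : {fraction {poly F}}) : (y + z)%:A = y%:A + z%:A :> K by exact: (rmorphD (in_alg K)).
elim/poly_ind: p => [|p r [c [d e]]].
  by exists 0, 0; rewrite rmorph0 horner0 scale0r mul0r addr0.
exists (d * tofrac D + r), c.
rewrite !rmorphD !rmorphM /= map_polyX map_polyC !hornerE e A M.
by rewrite -[_ r]/(r%:A) -[(tofrac D)%:A]s2; ring.
Qed.

Definition quad_to_field (z : quad D) : K := iota z.1 + iota z.2 * s.
Local Notation toK := quad_to_field.

Lemma quad_to_fieldM x y : toK (x * y) = toK x * toK y.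
Proof. by rewrite /toK quadM1 quadM2 !rmorphD !rmorphM /= -s2; ring. Qed.

Lemma quad_to_fieldD x y : toK (x + y) = toK x + toK y.
Proof. by rewrite /toK /= !rmorphD /=; ring. Qed.

Lemma quad_to_fieldN x : toK (- x) = - toK x.
Proof. by rewrite /toK /= !rmorphN /=; ring. Qed.

Lemma quad_to_field_scal p : toK (qscal D p) = iota p.
Proof. by rewrite /toK /= rmorph0 mul0r addr0. Qed.

Lemma quad_to_field_inj : injective toK.
Proof.
move=> x y e; have : toK (x - y) = 0 by rewrite quad_to_fieldD quad_to_fieldN e subrr.
move/quad_coord_eq0 => /= [/eqP e1 /eqP e2].
move: e1 e2; rewrite !tofrac_eq0 !subr_eq0 => /eqP e1 /eqP e2.
exact: quad_ext.
Qed.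

(** The ring of integers is exactly R[sqrt D]. For integral [x] with coordinates [a], [b], the trace
    [2a] is a polynomial, hence so is [a] because 2 is a nonzero constant; then [b ^+ 2 * D] is a
    polynomial, being the square of the integral element [x - a]. *)
Lemma ring_of_integers_quad (x : K) :
  ring_of_integers x <-> exists z, x = toK z.
Proof.
split; last first.
  case=> z ->; apply: integral_add; first exact: integral_id.
  by apply: integral_mul; [exact: integral_id | exact: integral_sqrt].
have [a [b ->]] := field_coord x.
move=> ix; have ix' : integralOver iota (a%:A - b%:A * s).
  have [p mp rp] := ix; exists p => //.
  have [c [d [e1 e2]]] := horner_quad_coord p a b.
  move/eqP: rp; rewrite e1 => /quad_coord_eq0 [c0 d0].
  by rewrite /root e2 c0 d0 scale0r mul0r subrr.
have [p1 ep1] : exists p, a *+ 2 = tofrac p.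
  apply: integral_scalar; have -> : (a *+ 2)%:A = (a%:A + b%:A * s) + (a%:A - b%:A * s) :> K.
    by rewrite -[LHS]/(in_alg K _) rmorphMn /=; ring.
  exact: integral_add.
have [c c0 two_c] : exists2 c : F, c != 0 & 2 = c%:P.
  exists 2; last by rewrite rmorphMn.
  by move: two_neq0; rewrite -[2](rmorph_nat (@polyC F)) polyC_eq0.
have [p ep] : exists p, a = tofrac p.
  exists (c^-1%:P * p1); rewrite tofracM -ep1.
  have -> : a *+ 2 = tofrac c%:P * a by rewrite -two_c rmorph_nat mulr_natl.
  by rewrite mulrA -tofracM -polyCM mulVf // tofrac1 mul1r.
have [r er] : exists p, b ^+ 2 * tofrac D = tofrac p.
  apply: integral_scalar.
  have -> : (b ^+ 2 * tofrac D)%:A = (a%:A + b%:A * s - iota p) ^+ 2 :> K.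
    rewrite -[LHS]/(in_alg K _) rmorphM rmorphXn /= -/(iota D) -s2 /poly_to_field -ep.
    by ring.
  rewrite expr2; have i : integralOver iota (a%:A + b%:A * s - iota p).
    by apply: integral_sub => //; exact: integral_id.
  exact: integral_mul.
have [n [d [d0 cnd bd]]] := fractionP b.
have id_ : n ^+ 2 * D = r * d ^+ 2.
  by apply: tofrac_inj; rewrite !expr2 !tofracM -er -bd; ring.
(* With [b = n / d] in lowest terms, square-freeness of [D] makes the denominator constant. *)
have dD : d ^+ 2 %| D.
  have co : coprimep (d ^+ 2) (n ^+ 2).
    by apply: coprimep_expl; apply: coprimep_expr; rewrite coprimep_sym.
  by rewrite -(Gauss_dvdpr _ co) id_ dvdp_mull.
have /eqP/size_poly1P[e e0 dE] := D_sqf dD.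
have [q eq] : exists q, b = tofrac q.
  exists (e^-1%:P * n); rewrite tofracM -bd dE mulrCA -tofracM -polyCM mulVf //.
  by rewrite tofrac1 mulr1.
by exists (p, q); rewrite ep eq.
Qed.

End QuadraticField.

(** * Hensel lifting of a square root of D modulo powers of P *)

Lemma hensel_sqrt (F : fieldType) (D b P : {poly F}) :
    (2 : {poly F}) != 0 -> P %| D - b ^+ 2 -> coprimep P b ->
  forall n, exists c, P ^+ n %| D - c ^+ 2 /\ coprimep P c.
Proof.
move=> two_neq0 dv cop n.
(* The given root is modulo [P], so the induction starts at exponent 1; exponent 0 follows by
   weakening. *)
suff [c [? ?]] : exists c, P ^+ n.+1 %| D - c ^+ 2 /\ coprimep P c.
  by exists c; split=> //; apply: dvdp_trans (dvdp_exp2l _ (leqnSn n)) _.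
elim: n => [|n [c [/dvdpP [r er] cc]]]; first by exists b.
have cc2 : coprimep P (2 * c).
  rewrite coprimepMr cc andbT; have -> : (2 : {poly F}) = (2 : F)%:P by rewrite rmorphMn rmorph1.
  have c2 : (2 : F) != 0 by rewrite -(@polyC_eq0 F) rmorphMn rmorph1.
  by apply/Bezout_eq1_coprimepP; exists (0, (2^-1)%:P); rewrite mul0r add0r -polyCM mulVf.
have /Bezout_eq1_coprimepP [[u w] /= uw] := cc2.
(* Newton step: [r] is the quotient of [D - c ^+ 2] by [P ^+ n.+1], and [w] inverts [2 * c] modulo
   [P]. *)
exists (c + w * r * P ^+ n.+1); split.
  have -> : D - (c + w * r * P ^+ n.+1) ^+ 2 =
      (r * u - (w * r) ^+ 2 * P ^+ n) * P ^+ n.+2.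
    have -> : D = c ^+ 2 + r * P ^+ n.+1 by rewrite -er; ring.
    have -> : r * P ^+ n.+1 = r * (u * P + w * (2 * c)) * P ^+ n.+1 by rewrite uw mulr1.
    by rewrite !exprS; ring.
  exact: dvdp_mull.
have -> : c + w * r * P ^+ n.+1 = (w * r * P ^+ n) * P + c by rewrite exprS; ring.
by rewrite coprimep_addl_mul.
Qed.

(** * Ideals cut out by a square root of D modulo N *)

Section RootIdeal.

Variables (F : fieldType) (D b : {poly F}).
Implicit Types (M N : {poly F}) (x y z : quad D).

(* The elements vanishing modulo N under sqrt D |-> b, when b^2 = D mod N. *)
Definition root_ideal N z := N %| z.1 + b * z.2.

Lemma root_ideal0 N : root_ideal N 0.
Proof. by rewrite /root_ideal /= mulr0 addr0 dvdp0. Qed.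

Lemma root_idealD N x y : root_ideal N x -> root_ideal N y -> root_ideal N (x + y).
Proof.
rewrite /root_ideal => hx hy; have -> : (x + y).1 + b * (x + y).2 =
  (x.1 + b * x.2) + (y.1 + b * y.2) by rewrite /=; ring.
exact: dvdp_add.
Qed.

Lemma root_idealM N x y : N %| D - b ^+ 2 -> root_ideal N y -> root_ideal N (x * y).
Proof.
rewrite /root_ideal => dv hy.
have -> : (x * y).1 + b * (x * y).2 =
    (x.1 + b * x.2) * (y.1 + b * y.2) + x.2 * y.2 * (D - b ^+ 2).
  by rewrite quadM1 quadM2; ring.
by rewrite dvdp_add // dvdp_mull.
Qed.

Lemma root_ideal_scal N : root_ideal N (qscal D N).
Proof. by rewrite /root_ideal /= mulr0 addr0. Qed.

(** The element sqrt D - b, which together with [N] generates [root_ideal N]. Its coordinate 1 keeps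
    it free of nonconstant polynomial factors. *)
Definition root_gen : quad D := (- b, 1).

Lemma root_ideal_gen N : root_ideal N root_gen.
Proof. by rewrite /root_ideal /= mulr1 addNr dvdp0. Qed.

(** The factor b + sqrt D lies in the conjugate ideal, and an ideal times its conjugate lies in the
    multiples of [N]. *)
Lemma root_ideal_conj N z : N %| D - b ^+ 2 -> root_ideal N z ->
  exists y, z * (b, 1) = qscal D N * y.
Proof.
move=> /dvdpP [q eq] /dvdpP [r er].
exists (b * r + z.2 * q, r).
have z1 : z.1 = r * N - b * z.2 by rewrite -er addrK.
have D_eq : D = b ^+ 2 + q * N by rewrite -eq; ring.
apply: quad_ext; rewrite ?quadM1 ?quadM2 /= z1 ?[in LHS]D_eq; ring.
Qed.

Lemma root_ideal_cross N x y : root_ideal N x -> root_ideal N y ->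
  N %| (x * qconj y).2.
Proof.
rewrite /root_ideal => hx hy.
have -> : (x * qconj y).2 = x.2 * (y.1 + b * y.2) - y.2 * (x.1 + b * x.2).
  by rewrite quadM2 /=; ring.
by rewrite dvdp_sub // dvdp_mull.
Qed.

End RootIdeal.

(** * Distinct ideal classes from powers of a split prime *)

Section RootIdealClasses.

Variables (F : fieldType) (D b : {poly F}).
Variables (K : fieldExtType {fraction {poly F}}) (s : K).
Hypothesis two_neq0 : (2 : {poly F}) != 0.
Hypothesis s2 : s ^+ 2 = poly_to_field K D.
Hypothesis s_gen : <<1%VS; s>>%VS = fullv.
Hypothesis D_nonsquare : ~ exists u : {poly F}, D = u ^+ 2.
Hypothesis D_sqf : squarefree_poly D.
Implicit Types (M N : {poly F}).

Local Notation toK := (@quad_to_field F D K s).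
Local Notation iota := (@poly_to_field F K).
Let toKM := quad_to_fieldM s2.
Let toK_inj := quad_to_field_inj s2 D_nonsquare.
Let OK x := ring_of_integers_quad two_neq0 s2 s_gen D_nonsquare D_sqf x.

Definition field_ideal N : set K := [set toK z | z in [set z | root_ideal b N z]]%classic.

Let iota_neq0 N : N != 0 -> iota N != 0.
Proof. by rewrite /poly_to_field scaler_eq0 oner_eq0 orbF tofrac_eq0. Qed.

Lemma field_ideal_fractional N : N != 0 -> N %| D - b ^+ 2 ->
  fractional_ideal (field_ideal N).
Proof.
move=> N0 dv; split.
- by exists 0; [exact: root_ideal0 | rewrite /quad_to_field rmorph0 mul0r addr0].
- move=> _ _ [x hx <-] [y hy <-]; exists (x + y); first exact: root_idealD.
  exact: quad_to_fieldD.
- move=> r _ /OK [x ->] [y hy <-]; exists (x * y); first exact: root_idealM.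
  exact: toKM.
- exists (iota N); last exact: iota_neq0.
  by exists (qscal D N); [exact: root_ideal_scal | exact: quad_to_field_scal].
- exists 1; first by split; [exact: integral1 | exact: oner_neq0].
  by move=> _ [x _ <-]; apply/OK; exists x; rewrite mul1r.
Qed.

(** The last two hypotheses say that multiplication by [y] carries the ideal of [N] onto that of
    [M]. *)
Lemma field_ideal_quotient M N (y : K) :
    M != 0 -> N != 0 -> N %| M -> M %| D - b ^+ 2 -> coprimep N (2 * b) ->
    (forall x, field_ideal N x -> field_ideal M (x * y)) ->
    (forall x, field_ideal M x -> exists2 x', field_ideal N x' & x = x' * y) ->
  exists z, [/\ y = toK z, qnorm z * N %| M & exists x, z * x = root_gen D b].
Proof.
move=> M0 N0 NM MD cop sub sup.
have ND : N %| D - b ^+ 2 := dvdp_trans NM MD.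
have inN (z : quad D) : root_ideal b N z -> field_ideal N (toK z) by exists z.
have inM (z : quad D) : root_ideal b M z -> field_ideal M (toK z) by exists z.
have [r hr er] := sub _ (inN _ (root_ideal_scal D b N)).
have [t _ et] := sub _ (inN _ (root_ideal_gen D b N)).
have [x ex] := root_ideal_conj ND (dvdp_trans NM hr).
have /Bezout_eq1_coprimepP [[u w] /= uw] := cop.
(* Here [r = N y] and [t = (sqrt D - b) y], while [x = (b + sqrt D) y]; thus [x - t = 2 b y], and
   the Bezout relation for [N] and [2 * b] recovers [y] as an integral element. *)
pose z : quad D := qscal D u * r + qscal D w * (x - t).
have yz : y = toK z.
  apply: (mulfI (iota_neq0 N0)).
  rewrite -[in RHS](quad_to_field_scal D s) -toKM.
  have -> : qscal D N * z = qscal D (u * N) * r + qscal D w * (r * (b, 1) - qscal D N * t).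
    by rewrite ex qscalM /z; ring.
  have uwK : iota u * iota N + iota w * (2 * iota b) = 1.
    by have := congr1 iota uw; rewrite rmorph1 rmorphD !rmorphM rmorph_nat.
  have toKb : toK (b, 1) = iota b + s by rewrite /quad_to_field /= rmorph1 mul1r.
  have toKg : toK (root_gen D b) = s - iota b.
    by rewrite /quad_to_field /= rmorphN rmorph1 mul1r addrC.
  rewrite quad_to_fieldD !toKM quad_to_fieldD quad_to_fieldN !toKM er et !quad_to_field_scal.
  by rewrite toKb toKg -[LHS]mul1r -uwK rmorphM; ring.
have [_ [d hd <-] ed] := sup _ (inM _ (root_ideal_scal D b M)).
have [_ [f hf <-] ef] := sup _ (inM _ (root_ideal_gen D b M)).
have zd : z * d = qscal D M by apply: toK_inj; rewrite ed toKM -yz mulrC.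
have zf : z * f = root_gen D b by apply: toK_inj; rewrite ef toKM -yz mulrC.
exists z; split=> //; last by exists f.
(* The determinant of [M] and [root_gen] is [- M]; it is also [qnorm z] times that of [d] and [f],
   which [N] divides. *)
have : (z * d * qconj (z * f)).2 = - M by rewrite zd zf quadM2 /=; ring.
have -> : z * d * qconj (z * f) = qscal D (qnorm z) * (d * qconj f).
  by rewrite qconjM mulrACA qnormE.
rewrite qscalM2 => eM; rewrite -[M]opprK -eM dvdpNr.
by apply: dvdp_mul => //; exact: root_ideal_cross hd hf.
Qed.

Lemma ideal_mul_principal N (x z : K) : N %| D - b ^+ 2 ->
  ideal_mul (field_ideal N) (principal_ideal x) z <->
  exists2 y, field_ideal N y & z = y * x.
Proof.
move=> dv; split.
  case=> l hl ->; elim: l hl => [|[u v] l IH] hl.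
    exists 0; last by rewrite big_nil mul0r.
    by exists 0; [exact: root_ideal0 | rewrite /quad_to_field rmorph0 mul0r addr0].
  have [|y hy ey] := IH; first by move=> w wl; apply: hl; rewrite inE wl orbT.
  have /= [[z1 hz1 <-] [_ /OK [z2 ->] <-]] := hl (u, v) (mem_head _ _).
  have [z3 hz3 e3] := hy.
  exists (toK (z2 * z1 + z3)).
    by eexists; [|reflexivity]; apply: root_idealD => //; exact: root_idealM.
  by rewrite big_cons ey /= quad_to_fieldD toKM -e3; ring.
case=> y hy ->; exists [:: (y, x)]; last by rewrite big_seq1.
move=> u; rewrite inE => /eqP -> /=; split=> //.
by exists 1; [exact: integral1 | rewrite mul1r].
Qed.

Variable e : nat.
Hypothesis small_norm : forall z : quad D, qnorm z != 0 -> (deg (qnorm z) < e)%N ->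
  exists r u, [/\ z = qscal D r * u, qnorm u != 0 & deg (qnorm u) = 0%N].

(** Equal classes would give a multiplier [z] whose norm has degree at most [deg M - deg N < e],
    hence a polynomial [r] times an element of constant norm. As [z] divides [root_gen], [r] is
    constant, so [qnorm z] is too. Then [qnorm z * N] lies in the ideal of [M], so [M] divides it,
    against [deg N < deg M]. *)
Lemma ideal_class_neq M N : M != 0 -> N != 0 -> N %| M -> M %| D - b ^+ 2 ->
    coprimep N (2 * b) -> (deg N < deg M < deg N + e)%N ->
  ideal_class (field_ideal N) <> ideal_class (field_ideal M).
Proof.
move=> M0 N0 NM MD cop /andP[lt small] eqc.
have ND : N %| D - b ^+ 2 := dvdp_trans NM MD.
have : ideal_class (field_ideal M) (ideal_mul (field_ideal M) (principal_ideal 1)).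
  by exists 1; first exact: oner_neq0.
rewrite -eqc => -[y y0 ey].
have sub x : field_ideal N x -> field_ideal M (x * y).
  move=> hx; have : ideal_mul (field_ideal N) (principal_ideal y) (x * y).
    by apply/ideal_mul_principal => //; exists x.
  by rewrite ey => /(ideal_mul_principal _ _ MD) [x' hx' ->]; rewrite mulr1.
have sup x : field_ideal M x -> exists2 x', field_ideal N x' & x = x' * y.
  move=> hx; apply/ideal_mul_principal => //; rewrite ey.
  by apply/ideal_mul_principal => //; exists x; rewrite ?mulr1.
have [z [yz nz [f zf]]] := field_ideal_quotient M0 N0 NM MD cop sub sup.
have nzN0 : qnorm z * N != 0 by apply: contraNneq M0 => e0; move: nz; rewrite e0 dvd0p.
have nz0 : qnorm z != 0 by apply: contraNneq nzN0 => ->; rewrite mul0r.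
have dnz : (deg (qnorm z) < e)%N.
  have := dvdp_leq M0 nz; rewrite !deg_size // ltnS degM //; lia.
have [r [u [zru nu du]]] := small_norm nz0 dnz.
have r1 : r %| 1.
  have := congr1 snd zf; rewrite zru -mulrA qscalM2 /= => <-.
  by rewrite dvdp_mulr.
have r0 : r != 0 by apply: contraTneq r1 => ->; rewrite dvd0p oner_neq0.
have dr : deg r = 0%N by move: r1; rewrite dvdp1 /deg => /eqP ->.
have dz0 : deg (qnorm z) = 0%N.
  by rewrite zru qnormM qnorm_scal degM ?expf_neq0 // degX // dr du.
have [w hw ew] : field_ideal M (toK (qscal D N) * y).
  by apply: sub; exists (qscal D N) => //; exact: root_ideal_scal.
have wE : w = qscal D N * z by apply: toK_inj; rewrite ew toKM yz.
have := root_idealM (qconj z) MD hw.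
have -> : qconj z * w = qscal D (qnorm z * N) by rewrite wE qscalM -qnormE; ring.
rewrite /root_ideal /= mulr0 addr0 => /(dvdp_leq nzN0).
by rewrite !deg_size // ltnS degM // dz0 leqNgt lt.
Qed.

Lemma class_number_ge (P : {poly F}) n : (0 < deg P)%N -> coprimep P (2 * b) ->
    P ^+ n %| D - b ^+ 2 -> (n.-1 * deg P < e)%N ->
  (n%:R%:E <= class_number K)%E.
Proof.
move=> P0 cop PD small.
have Pn0 : P != 0 by apply: contraTneq P0 => ->; rewrite /deg size_poly0.
rewrite /class_number /cardinal_order; case: asboolP => [fin|_]; last exact: leey.
pose f (i : 'I_n) := ideal_class (field_ideal (P ^+ i)).
have PiD i : (i <= n)%N -> P ^+ i %| D - b ^+ 2.
  by move=> le; apply: dvdp_trans PD; exact: dvdp_exp2l.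
have neq (i j : 'I_n) : (i < j)%N -> f i <> f j.
  move=> ij; apply: ideal_class_neq; rewrite ?expf_neq0 ?dvdp_exp2l ?PiD //.
  - exact: ltnW.
  - exact: ltnW.
  - exact: coprimep_expl.
  (* The degrees are [j * deg P] and [i * deg P], and already [j * deg P <= n.-1 * deg P < e]. *)
  rewrite !degX // ltn_pmul2r // ij /=.
  have jn : (j <= n.-1)%N by have := ltn_ord j; lia.
  apply: (@leq_ltn_trans (n.-1 * deg P)); first by rewrite leq_mul2r jn orbT.
  exact: leq_trans small (leq_addl _ _).
have finj : injective f.
  move=> i j eqf; apply: val_inj; case: (ltngtP i j) => // h.
    by case: (neq _ _ h).
  by case: (neq _ _ h).
rewrite lee_fin ler_nat.
rewrite -[X in (X <= _)%N](card_ord n) cardE -(size_map f).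
apply: uniq_leq_size; first by rewrite map_inj_uniq ?enum_uniq.
move=> _ /mapP [i _ ->]; rewrite in_fset_set // inE /=.
exists (field_ideal (P ^+ i)) => //.
by apply: field_ideal_fractional; rewrite ?expf_neq0 ?PiD // ltnW.
Qed.

End RootIdealClasses.

(** * The degree of B, and the class number bound *)

Lemma kreeper_deg (F : fieldType) (D A B k t : {poly F}) (m : nat) :
    (2 : F) != 0 -> k ^+ 2 = 1 -> t ^+ 2 = 1 -> D = B ^+ 2 + t * A ->
    2 * B + k = 2 * A ^+ m + k * t * A -> A \is monic -> (0 < deg A)%N ->
    (0 < m)%N -> D \is monic -> D <> A + 1 -> deg B = (m * deg A)%N.
Proof.
move=> two k2 t2 DE BE mA A0 m0 mD DA1.
have An0 : A != 0 by rewrite monic_neq0.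
have two' : (2 : {poly F}) = (2 : F)%:P by rewrite rmorphMn rmorph1.
have deg_const_mul (c : F) (p : {poly F}) : c != 0 -> deg (c%:P * p) = deg p.
  by move=> c0; rewrite /deg mul_polyC size_scale.
have sz1 (p : {poly F}) : p ^+ 2 = 1 -> size p = 1%N.
  move=> h; have p0 : p != 0 by apply: contra_eq_neq h => ->; rewrite expr0n eq_sym oner_neq0.
  by rewrite deg_size // deg_sqr1.
have -> : deg B = deg (2 * B) by rewrite two' deg_const_mul.
have -> : 2 * B = 2 * A ^+ m + (k * t * A - k) by rewrite -[LHS](addrK k) BE addrA.
have szA : (1 < size A)%N by rewrite deg_size.
have kt2 : (k * t) ^+ 2 = 1 by rewrite exprMn k2 t2 mulr1.
have szk (c : F) : c != 0 -> deg (c%:P * A - k) = deg A.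
  move=> c0; rewrite /deg size_polyDl; first exact: deg_const_mul.
  by rewrite size_polyN (sz1 _ k2) mul_polyC size_scale.
(* For [m >= 2] the term [2 * A ^+ m] alone fixes the degree. For [m = 1] the coefficient of [A] is
   [2 + k * t], that is 3 or 1, and only 3 can vanish. *)
have [m1|m2] := leqP m 1; last first.
  rewrite {1}/deg size_polyDl; first by rewrite -/(deg _) two' deg_const_mul // degX.
  have szkt : size (k * t * A) = size A.
    by rewrite size_mul // ?(sz1 _ kt2) // -size_poly_gt0 (sz1 _ kt2).
  have -> : size (k * t * A - k) = size A.
    rewrite size_polyDl; last first.
      by rewrite size_polyN (sz1 _ k2) szkt.
    exact: szkt.
  rewrite two' mul_polyC size_scale // !deg_size ?expf_neq0 // degX // ltnS.
  by rewrite -{1}[deg A]mul1n ltn_pmul2r.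
have {m0 m1} m1 : m = 1%N by apply/eqP; rewrite eqn_leq m1.
move: BE; rewrite m1 mul1n expr1 => BE.
have -> : 2 * A + (k * t * A - k) = (2 + k * t) * A - k by ring.
have /orP[/eqP kt|/eqP kt] : (k * t == 1) || (k * t == -1) by rewrite -sqrf_eq1 kt2.
  rewrite kt; have -> : (2 + 1 : {poly F}) = (3 : F)%:P by rewrite rmorphMn rmorph1; ring.
  have [three|] := eqVneq (3 : F) 0; last exact: szk.
  have three' : (3 : {poly F}) = 0 by rewrite -(rmorph_nat (@polyC F)) three.
  have Bk : B = k.
    apply/eqP; rewrite -subr_eq0; apply/eqP.
    have -> : B - k = 3 * B - 3 * A - (2 * B + k - (2 * A + 1 * A)) by ring.
    by rewrite BE kt three' !mul0r; ring.
  case/orP: (etrans (esym (sqrf_eq1 t)) (introT eqP t2)) => /eqP tE.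
    by case: DA1; rewrite DE Bk k2 tE; ring.
  (* Now [D = 1 - A] has leading coefficient -1, so being monic would force 2 = 0. *)
  move: mD; rewrite DE Bk k2 tE mulN1r addrC monicE lead_coefDl; last first.
    by rewrite size_polyN size_poly1.
  rewrite lead_coefN (monicP mA) => /eqP h.
  by case/eqP: two; rewrite -[LHS]/(1 + 1) -[X in X + _]h addNr.
rewrite kt; have -> : (2 - 1 : {poly F}) = 1%:P by ring.
exact: szk (oner_neq0 _).
Qed.

(* hD1 only removes the degenerate D = A + 1, which arises when F has
   characteristic 3, m = 1 and D = (A + a)^2 + A, since then A + a = 1; for
   it the bound fails: over F_3, D = T^4 + T + 1 and P = T give h(D) = 1
   while deg (S P) / deg P = 4. *)
Theorem corollary3 (p e : nat) (F : finFieldType)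
    (p_prime : prime p) (p_odd : odd p) (hq : #|F| = (p ^ e)%N)
    (a A S P D : {poly F}) (m : nat)
    (ha : (0 < deg a)%N) (hA : A = 2 * a + 1) (hAmonic : A \is monic)
    (hm : (0 < m)%N)
    (hSP : A = S * P) (hP : irreducible_poly P) (hS : (2 <= deg S)%N)
    (hD : [\/ D = (A ^+ m + a) ^+ 2 + A,
              D = (A ^+ m - a) ^+ 2 + A,
              D = (A ^+ m + a + 1) ^+ 2 - A |
              D = (A ^+ m - a - 1) ^+ 2 - A])
    (hD1 : D <> A + 1)
    (hDsqf : squarefree_poly D)
    (K : fieldExtType {fraction {poly F}}) (hK : real_quadratic K D) :
  (((deg (S * P))%:R / (deg P)%:R)%:E <= class_number K)%E /\
  (1 < (deg (S * P))%:R / (deg P)%:R :> rat).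
Proof.
have [mD _ nsq [s s2 sgen]] := hK.
have two : (2 : F) != 0.
  apply: contraTneq p_odd => two0.
  have pF : p \in [pchar F] by exact: card_finPcharP hq p_prime.
  have : 2%N \in [pchar F] by rewrite inE /= two0 eqxx.
  by rewrite (pcharf_eq pF) inE => /eqP <-.
have two' : (2 : {poly F}) != 0.
  by rewrite -(rmorph_nat (@polyC F)) polyC_eq0.
have [szP _] := hP.
have dP : (0 < deg P)%N by rewrite /deg -subn1 subn_gt0.
have nz (q : {poly F}) : (0 < deg q)%N -> q != 0.
  by apply: contraTneq => ->; rewrite /deg size_poly0.
have P0 := nz _ dP; have S0 : S != 0 by apply: nz; exact: ltnW.
have dA : deg A = (deg S + deg P)%N by rewrite hSP degM.
have dA0 : (0 < deg A)%N by rewrite dA addn_gt0 dP orbT.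
split; last first.
  rewrite ltr_pdivlMr ?ltr0n // mul1r ltr_nat -hSP dA -[X in (X < _)%N]add0n ltn_add2r.
  exact: ltnW.
(* In the four cases [t] is the sign of [A] in [D] and [k * t] is the sign of [a] in [B]; the last
   relation comes from [2 * a = A - 1]. *)
have [k [t [B [k2 t2 DE BE]]]] : exists k t B : {poly F},
    [/\ k ^+ 2 = 1, t ^+ 2 = 1, D = B ^+ 2 + t * A &
        2 * B + k = 2 * A ^+ m + k * t * A].
  have twoa : 2 * a = A - 1 by rewrite hA addrK.
  case: hD => ->.
  - exists 1, 1, (A ^+ m + a); split; [ring | ring | ring | ].
    by transitivity (2 * A ^+ m + 2 * a + 1); [ring | rewrite twoa; ring].
  - exists (-1), 1, (A ^+ m - a); split; [ring | ring | ring | ].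
    by transitivity (2 * A ^+ m - 2 * a - 1); [ring | rewrite twoa; ring].
  - exists (-1), (-1), (A ^+ m + a + 1); split; [ring | ring | ring | ].
    by transitivity (2 * A ^+ m + 2 * a + 1); [ring | rewrite twoa; ring].
  - exists 1, (-1), (A ^+ m - a - 1); split; [ring | ring | ring | ].
    by transitivity (2 * A ^+ m - 2 * a - 1); [ring | rewrite twoa; ring].
have dB := kreeper_deg two k2 t2 DE BE hAmonic dA0 hm mD hD1.
have PA : P %| A by rewrite hSP dvdp_mull.
(* Since [P] divides [A] and [m > 0], [2 * B] is congruent to [- k] modulo [P]. *)
have cop2B : coprimep P (2 * B).
  have [r Ar] := dvdpP _ _ PA; case: m hm BE {dB hD} => // n _ BE.
  have -> : 2 * B = (2 * A ^+ n * r + k * t * r) * P + - k.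
    rewrite -[LHS](addrK k) BE exprSr.
    by transitivity (2 * (A ^+ n * (r * P)) + k * t * (r * P) - k); [rewrite -Ar | ring].
  by rewrite coprimep_addl_mul coprimep_sqr1 // sqrrN.
move: (cop2B); rewrite coprimepMr => /andP[cop2 copB].
have PD : P %| D - B ^+ 2.
  by rewrite DE [_ + _ * A]addrC addrK dvdp_mull.
(* This is [deg A / deg P] rounded up, the largest [n] with [n.-1 * deg P < deg A]. *)
pose n := ((deg A).-1 %/ deg P).+1.
have [b [bD copb]] := hensel_sqrt two' PD copB n.
have small z := @small_norm _ D A B k t m two' k2 t2 DE BE dA0 hm dB z.
have cop2b : coprimep P (2 * b) by rewrite coprimepMr cop2.
have n_small : (n.-1 * deg P < deg A)%N.
  by rewrite -[X in (_ < X)%N](prednK dA0) ltnS leq_trunc_div.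
apply: le_trans (class_number_ge two' s2 sgen nsq hDsqf small dP cop2b bD n_small).
rewrite lee_fin ler_pdivrMr ?ltr0n // -natrM ler_nat -hSP.
by rewrite -(prednK dA0) ltn_ceil.
Qed.
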